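(* Let $f:\mathbb{R}^2\to\mathbb{R}^2$ be defined by $f(\theta)=\theta$ and $f((x_1,x_2))=\left(\frac{x_1^2-x_2^2}{\sqrt{x_1^2+x_2^2}},\frac{2x_1x_2}{\sqrt{x_1^2+x_2^2}}\right)$ for $(x_1,x_2)\in\mathbb{R}^2\setminus\{\theta\}$, where $\theta$ is the origin. Let $z=(z_1,z_2)\in\mathbb{R}^2\setminus\{\theta\}$. Then: (a) $f$ is Fréchet differentiable at $z$ and $$\nabla f(z)=\begin{pmatrix}\frac{(z_1^2+3z_2^2)z_1}{(z_1^2+z_2^2)\sqrt{z_1^2+z_2^2}} & \frac{2z_2^2z_2}{(z_1^2+z_2^2)\sqrt{z_1^2+z_2^2}}\\ \frac{-(3z_1^2+z_2^2)z_2}{(z_1^2+z_2^2)\sqrt{z_1^2+z_2^2}} & \frac{2z_1^2z_1}{(z_1^2+z_2^2)\sqrt{z_1^2+z_2^2}}\end{pmatrix}.$$ (b) $f$ is Mordukhovich differentiable at $z$ and $$\widehat{D}^*f(z)=\begin{pmatrix}\frac{(z_1^2+3z_2^2)z_1}{(z_1^2+z_2^2)\sqrt{z_1^2+z_2^2}} & \frac{-(3z_1^2+z_2^2)z_2}{(z_1^2+z_2^2)\sqrt{z_1^2+z_2^2}}\\ \frac{2z_2^2z_2}{(z_1^2+z_2^2)\sqrt{z_1^2+z_2^2}} & \frac{2z_1^2z_1}{(z_1^2+z_2^2)\sqrt{z_1^2+z_2^2}}\end{pmatrix}.$$ More precisely, for $x=(x_1,x_2),\,y=(y_1,y_2)\in\mathbb{R}^2$,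 if $x=\widehat{D}^*f(z)(y)$, then $$x_1=y_1\frac{(z_1^2+3z_2^2)z_1}{(z_1^2+z_2^2)\sqrt{z_1^2+z_2^2}}+y_2\frac{2z_2^2z_2}{(z_1^2+z_2^2)\sqrt{z_1^2+z_2^2}},$$ $$x_2=y_1\frac{(-3z_1^2-z_2^2)z_2}{(z_1^2+z_2^2)\sqrt{z_1^2+z_2^2}}+y_2\frac{2z_1^2z_1}{(z_1^2+z_2^2)\sqrt{z_1^2+z_2^2}}.$$
   Context: $\mathbb{R}^n$ carries the Euclidean norm $\|\cdot\|$ and inner product $\langle\cdot,\cdot\rangle$; vectors are row vectors. A mapping $g:\mathbb{R}^n\to\mathbb{R}^m$ is Fréchet differentiable at $z$ with Fréchet derivative the linear map $\nabla g(z)$ if $\lim_{u\to z}\frac{g(u)-g(z)-\nabla g(z)(u-z)}{\|u-z\|}=\theta$; $\nabla g(z)$ is identified with the $n\times m$ matrix $A$ such that $\nabla g(z)(v)=vA$ for row vectors $v$. For continuous $g:\mathbb{R}^n\to\mathbb{R}^m$, $x\in\mathbb{R}^n$, $y\in\mathbb{R}^m$, the Mordukhovich derivative (coderivative) is the set $$\widehat{D}^*g(x)(y)=\left\{z\in\mathbb{R}^n:\ \limsup_{u\to x}\frac{\langle z,u-x\rangle-\langle y,g(u)-g(x)\rangle}{\|u-x\|+\|g(u)-g(x)\|}\le 0\right\},$$ and $g$ is Mordukhovich differentiable at $x$ if this set is nonempty for every $y\in\mathbb{R}^m$. Writing $\widehat{D}^*g(x)=M$ for an $m\times n$ matrix $M$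 means that $\widehat{D}^*g(x)(y)=\{yM\}$ for every row vector $y\in\mathbb{R}^m$. When $\widehat{D}^*g(x)(y)$ is a singleton it is identified with its element, so $x'=\widehat{D}^*g(x)(y)$ means $\widehat{D}^*g(x)(y)=\{x'\}$. *)

(* Defs.v *)
From HB Require Import structures.
From mathcomp Require Import all_boot all_order all_algebra.
From mathcomp Require Import all_classical all_reals all_analysis.
From mathcomp Require Import ring lra.

Set Implicit Arguments.
Unset Strict Implicit.
Unset Printing Implicit Defensive.
Import Order.TTheory GRing.Theory Num.Theory.
Import numFieldNormedType.Exports.
Local Open Scope classical_set_scope.
Local Open Scope ring_scope.

Definition dotv (R : realType) (n : nat) (u v : 'rV[R]_n) : R :=
  \sum_(i < n) u 0 i * v 0 i.

(* The canonical norm [`|v|] on ['rV[R]_n] is the sup norm. *)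
Definition enorm (R : realType) (n : nat) (v : 'rV[R]_n) : R :=
  Num.sqrt (dotv v v).

(* The formula makes sense for every [g], but is intended for continuous maps
   only; [sqn] below is one, see [sqn_continuous].
   [x^'] is the filter of punctured neighbourhoods of [x]. *)
Definition coderivative (R : realType) (n m : nat)
    (g : 'rV[R]_n -> 'rV[R]_m) (x : 'rV[R]_n) (y : 'rV[R]_m) :
    set 'rV[R]_n :=
  [set z : 'rV[R]_n |
    (limf_esup
      (fun u : 'rV[R]_n => ((dotv z (u - x) - dotv y (g u - g x)) /
                 (enorm (u - x) + enorm (g u - g x)))%:E)
      x^' <= 0)%E].

Definition mordukhovich_differentiable (R : realType) (n m : nat)
    (g : 'rV[R]_n -> 'rV[R]_m) (x : 'rV[R]_n) : Prop :=
  forall y : 'rV[R]_m, coderivative g x y !=set0.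

Definition coderivative_eq_mx (R : realType) (n m : nat)
    (g : 'rV[R]_n -> 'rV[R]_m) (x : 'rV[R]_n) (M : 'M[R]_(m, n)) : Prop :=
  forall y : 'rV[R]_m, coderivative g x y = [set y *m M].

Definition vec2 (R : realType) (a b : R) : 'rV[R]_2 :=
  \row_(j < 2) if j == 0 then a else b.

(* [mat2 a b c d] has rows [(a, b)] and [(c, d)]. *)
Definition mat2 (R : realType) (a b c d : R) : 'M[R]_2 :=
  \matrix_(i < 2, j < 2)
    if i == 0 then (if j == 0 then a else b) else (if j == 0 then c else d).

Definition sqn (R : realType) (x : 'rV[R]_2) : 'rV[R]_2 :=
  if x == 0 then 0 else
  let x1 := x 0 0 in let x2 := x 0 1 in
  vec2 ((x1 ^+ 2 - x2 ^+ 2) / Num.sqrt (x1 ^+ 2 + x2 ^+ 2))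
       (2 * x1 * x2 / Num.sqrt (x1 ^+ 2 + x2 ^+ 2)).

Lemma normv_le_enorm (R : realType) (n : nat) (v : 'rV[R]_n) :
  `|v| <= enorm v.
Proof.
rewrite /Num.norm/= mx_normrE; apply: bigmax_le; first exact: sqrtr_ge0.
case=> i j _ /=; rewrite ord1 -sqrtr_sqr ler_sqrt ?sqr_ge0//; last first.
  by apply: sumr_ge0 => k _; rewrite -expr2 sqr_ge0.
rewrite /dotv (bigD1 j)//= -expr2 lerDl.
by apply: sumr_ge0 => k _; rewrite -expr2 sqr_ge0.
Qed.

Lemma normv_coord (R : realType) (n : nat) (v : 'rV[R]_n) j : `|v 0 j| <= `|v|.
Proof.
by rewrite {2}/Num.norm/= mx_normrE; apply: (le_bigmax _ _ (0, j)).
Qed.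

Lemma enorm_le_normv (R : realType) (n : nat) (v : 'rV[R]_n) :
  enorm v <= n%:R * `|v|.
Proof.
have h0 : 0 <= n%:R * `|v| by rewrite mulr_ge0.
rewrite -(ger0_norm h0) -sqrtr_sqr ler_sqrt ?sqr_ge0// exprMn.
apply: (@le_trans _ _ (n%:R * `|v| ^+ 2)).
  rewrite /dotv mulr_natl -[X in _ *+ X]card_ord -sumr_const.
  apply: ler_sum => k _; rewrite -expr2 -real_normK ?num_real//.
  by rewrite lerXn2r// ?nnegrE// normv_coord.
rewrite ler_wpM2r ?sqr_ge0//.
by case: (n) => [|m]; rewrite ?expr0n// expr2 ler_peMl// ler1n.
Qed.

Lemma mulmxr_continuous (R : realType) (n m : nat) (A : 'M[R]_(n, m)) :
  continuous (fun v : 'rV[R]_n => v *m A).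
Proof.
have -> : (fun v : 'rV[R]_n => v *m A) = mulmxr A by [].
apply/linear_bounded_continuous.
pose C := \sum_k \sum_j `|A k j|.
have C0 : 0 <= C by apply: sumr_ge0 => k _; apply: sumr_ge0.
have key (v : 'rV[R]_n) : `|v *m A| <= `|v| * C.
  rewrite {1}/Num.norm/= mx_normrE; apply: bigmax_le; first by rewrite mulr_ge0.
  case=> i j _ /=; rewrite ord1 mxE mulr_sumr.
  apply: le_trans (ler_norm_sum _ _ _) _.
  apply: ler_sum => k _; rewrite normrM ler_pM// ?normv_coord//.
  by rewrite (bigD1 j)//= lerDl sumr_ge0.
exists C; split; first exact: num_real.
move=> M CM; apply/nbhs_ballP; exists 1 => //= v.
rewrite -ball_normE/= sub0r normrN => v1.
apply: le_trans (key v) _; apply: le_trans (ltW CM).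
by rewrite ler_piMl// ltW.
Qed.

Lemma is_differential_nearP (K : numFieldType) (V W : normedModType K)
    (f : V -> W) (df : {linear V -> W}) (x : V) : continuous df ->
  (differentiable f x /\ 'd f x = df :> (V -> W)) <->
  (forall e : K, 0 < e ->
     \forall u \near x, `|f u - f x - df (u - x)| <= e * `|u - x|).
Proof.
move=> cdf; have -> : (differentiable f x /\ 'd f x = df :> (V -> W)) <->
    f \o shift x = cst (f x) + df +o_ 0 id.
  split=> [[dg dE]|dg].
    by have /diff_locallyP [_] := dg; rewrite dE.
  have dE := diff_unique cdf dg.
  by split=> //; apply/(diff_locallyP x f); rewrite dE; split.
rewrite eqaddoP; split=> H e e0; have := H e e0.
- rewrite [X in X -> _](near_shift x); apply: filterS => u /=.
  by rewrite !fctE /= sub0r subrK opprD addrA.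
- rewrite [X in _ -> X](near_shift x); apply: filterS => u /=.
  by rewrite !fctE /= sub0r subrK opprD addrA.
Qed.

(* The library's differentiability and Jacobian, which refer to the sup norm,
   coincide with the Fréchet derivative defined with the Euclidean norm. *)
Lemma differentiable_enormP (R : realType) (n m : nat)
    (g : 'rV[R]_n -> 'rV[R]_m) (z : 'rV[R]_n) (A : 'M[R]_(n, m)) :
  (differentiable g z /\ 'J g z = A) <->
  (enorm (u - z))^-1 *: (g u - g z - (u - z) *m A) @[u --> z^'] -->
    (0 : 'rV[R]_m).
Proof.
pose df : {linear 'rV[R]_n -> 'rV[R]_m} := mulmxr A.
have cdf : continuous df by exact: mulmxr_continuous.
have -> : (differentiable g z /\ 'J g z = A) <->
    (differentiable g z /\ 'd g z = df :> ('rV[R]_n -> 'rV[R]_m)).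
  split=> -[dg E]; split=> //.
    by rewrite funeqE => h; rewrite /df/= -E mul_rV_lin1.
  by rewrite /jacobian; apply/row_matrixP => i; rewrite !rowE mul_rV_lin1/= E.
rewrite (is_differential_nearP _ _ cdf) /df/=; split.
- move=> H; apply/cvgr0Pnorm_le => e e0; rewrite /dnbhs /within/=.
  have := H e e0; apply: filterS => u /= Hu uz.
  have uz0 : 0 < enorm (u - z).
    by apply: lt_le_trans (normv_le_enorm _); rewrite normr_gt0 subr_eq0.
  rewrite normrZ gtr0_norm ?invr_gt0// mulrC ler_pdivrMr//.
  apply: le_trans Hu _.
  by rewrite ler_wpM2l ?normv_le_enorm// ltW.
- move=> /cvgr0Pnorm_le H e e0.
  have n0 : 0 < (n.+1%:R : R) by rewrite ltr0n.
  have Hn : \forall u \near z, u != z ->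
      `|(enorm (u - z))^-1 *: (g u - g z - (u - z) *m A)| <= e / n.+1%:R.
    exact: H (divr_gt0 e0 n0).
  near=> u; have Hu : u != z ->
      `|(enorm (u - z))^-1 *: (g u - g z - (u - z) *m A)| <= e / n.+1%:R.
    by near: u.
  have [->|uz] := eqVneq u z.
    by rewrite !subrr mul0mx subr0 !normr0 mulr0.
  have uz0 : 0 < enorm (u - z).
    by apply: lt_le_trans (normv_le_enorm _); rewrite normr_gt0 subr_eq0.
  have := Hu uz; rewrite normrZ gtr0_norm ?invr_gt0// mulrC ler_pdivrMr//.
  move=> /le_trans; apply.
  rewrite -mulrA (ler_pM2l e0) ler_pdivrMl//.
  apply: ltW; apply: le_lt_trans (enorm_le_normv _) _.
  by rewrite ltr_pM2r ?normr_gt0 ?subr_eq0// ltr_nat.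
Unshelve. all: by end_near. Qed.

Lemma vec2_cvg (R : realType) (T : Type) (F : set_system T)
    (FF : Filter F) (f g : T -> R) (a b : R) :
  f @ F --> a -> g @ F --> b -> vec2 (f u) (g u) @[u --> F] --> vec2 a b.
Proof.
have E (c d : R) : vec2 c d = c *: vec2 1 0 + d *: vec2 0 1.
  apply/rowP => j; rewrite !mxE.
  by case: ifP => _; rewrite ?mulr0 ?mulr1 ?addr0 ?add0r.
move=> fa gb; rewrite (E a b) (_ : (fun u => vec2 (f u) (g u)) =
    (fun u => f u *: vec2 1 0 + g u *: vec2 0 1)).
  exact: (cvgD (cvgZr_tmp fa) (cvgZr_tmp gb)).
by rewrite funeqE => u; exact: E.
Qed.

Lemma sqn_continuous (R : realType) : continuous (@sqn R).
Proof.
pose q (x : 'rV[R]_2) : R := x 0 0 ^+ 2 + x 0 1 ^+ 2.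
have q0 x : 0 <= q x by rewrite addr_ge0 ?sqr_ge0.
have q_gt0 x : x != 0 -> 0 < q x.
  rewrite lt_neqAle q0 andbT (eq_sym 0); apply: contra_neq => /eqP.
  rewrite /q paddr_eq0 ?sqr_ge0// !sqrf_eq0 => /andP[/eqP x1 /eqP x2].
  apply/rowP => j; rewrite mxE; case: j => -[|[|//]] jlt.
    by rewrite -[RHS]x1; congr (x _ _); exact/val_inj.
  by rewrite -[RHS]x2; congr (x _ _); exact/val_inj.
move=> x; have [->|x0] := eqVneq x 0.
  rewrite /continuous_at; apply: (proj2 (@cvgrPdist_le R 'rV[R]_2 'rV[R]_2
    (nbhs (0 : 'rV[R]_2)) (nbhs_filter _) (@sqn R) (sqn 0))) => e e0.
  have s0 : @sqn R 0 = 0 by rewrite /sqn eqxx.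
  rewrite s0.
  apply/nbhs_ballP; exists (e / 2) => /=; first by rewrite divr_gt0.
  move=> u; rewrite -ball_normE/= !sub0r !normrN => ue.
  rewrite /sqn; have [_|u0] := eqVneq u 0; first by rewrite normr0 ltW.
  have qu := q_gt0 _ u0; have squ : 0 < Num.sqrt (q u) by rewrite sqrtr_gt0.
  have sqe : Num.sqrt (q u) <= e.
    rewrite -(ger0_norm (ltW e0)) -sqrtr_sqr ler_sqrt ?sqr_ge0// /q.
    have h j : u 0 j ^+ 2 <= (e / 2) ^+ 2.
      rewrite -real_normK ?num_real// lerXn2r// ?nnegrE ?divr_ge0 ?ltW//.
      exact: le_lt_trans (normv_coord _ _) ue.
    have := h 0; have := h 1; nra.
  have bd (t : R) : `|t| <= q u -> `|t / Num.sqrt (q u)| <= e.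
    move=> tq; apply: le_trans sqe.
    rewrite normrM normfV (ger0_norm (ltW squ)) ler_pdivrMr//.
    by rewrite -expr2 sqr_sqrtr.
  rewrite {1}/Num.norm/= mx_normrE; apply: bigmax_le; first exact: ltW.
  case=> i j _ /=; rewrite ord1 mxE; case: ifP => _; apply: bd; rewrite /q.
    rewrite ler_norml; have := sqr_ge0 (u 0 0); have := sqr_ge0 (u 0 1).
    by move=> ? ?; apply/andP; split; lra.
  rewrite ler_norml; have := sqr_ge0 (u 0 0 + u 0 1).
  have := sqr_ge0 (u 0 0 - u 0 1).
  by rewrite !expr2 => ? ?; apply/andP; split; nra.
have cc j : (fun u : 'rV[R]_2 => u 0 j) @ nbhs x --> x 0 j by exact: coord_continuous.
have cc2 j : (fun u : 'rV[R]_2 => u 0 j ^+ 2) @ nbhs x --> x 0 j ^+ 2.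
  exact: (cvgM (cc j) (cc j)).
have cq : q @ nbhs x --> q x by exact: (cvgD (cc2 0) (cc2 1)).
have sx0 : Num.sqrt (q x) != 0 by rewrite gt_eqF// sqrtr_gt0 q_gt0.
have cs : (fun u => (Num.sqrt (q u))^-1) @ nbhs x --> (Num.sqrt (q x))^-1.
  exact: (cvgV sx0 (cvg_comp q (@Num.sqrt R) cq (@sqrt_continuous R (q x)))).
have c1 : (fun u : 'rV[R]_2 => (u 0 0 ^+ 2 - u 0 1 ^+ 2) / Num.sqrt (q u))
    @ nbhs x --> (x 0 0 ^+ 2 - x 0 1 ^+ 2) / Num.sqrt (q x).
  exact: (cvgM (cvgB (cc2 0) (cc2 1)) cs).
have c2 : (fun u : 'rV[R]_2 => 2 * u 0 0 * u 0 1 / Num.sqrt (q u))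
    @ nbhs x --> 2 * x 0 0 * x 0 1 / Num.sqrt (q x).
  exact: (cvgM (cvgM (cvgM (cvg_cst (2 : R)) (cc 0)) (cc 1)) cs).
have sE (u : 'rV[R]_2) : u != 0 ->
    vec2 ((u 0 0 ^+ 2 - u 0 1 ^+ 2) / Num.sqrt (q u))
         (2 * u 0 0 * u 0 1 / Num.sqrt (q u)) = sqn u.
  by rewrite /sqn => /negbTE ->.
have cv := vec2_cvg (nbhs_filter _) c1 c2; rewrite (sE x x0) in cv.
have u0 : nbhs x [set u : 'rV[R]_2 | 0 < `|u|].
  have x1 : 0 < `|x : 'rV[R]_2| by rewrite normr_gt0.
  exact: (cvgr_gt _ (@norm_continuous _ 'rV[R]_2 x) _ x1).
have N : nbhs x [set u : 'rV[R]_2 |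
    vec2 ((u 0 0 ^+ 2 - u 0 1 ^+ 2) / Num.sqrt (q u))
         (2 * u 0 0 * u 0 1 / Num.sqrt (q u)) = sqn u].
  by apply: filterS u0 => u /=; rewrite normr_gt0; exact: sE.
exact: (cvg_trans (near_eq_cvg N) cv).
Qed.

(* Main.v *)
From HB Require Import structures.
Require Import Defs.
From mathcomp Require Import all_boot all_order all_algebra.
From mathcomp Require Import all_classical all_reals all_analysis.
From mathcomp Require Import ring lra.

Set Implicit Arguments.
Unset Strict Implicit.
Unset Printing Implicit Defensive.
Import Order.TTheory GRing.Theory Num.Theory.
Import numFieldNormedType.Exports.
Local Open Scope classical_set_scope.
Local Open Scope ring_scope.

(** Part (b) is an instance of a general fact, [coderivative_of_differentiable]:
    where [g] is Fréchet differentiable with Jacobian [A], its coderivative is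
    the transpose of [A].  Put [h := u - x] and [w := z - y *m A^T].  Then

      <z, h> - <y, g u - g x> = <w, h> - <y, o(h)>,

    and the denominator [|h| + |g u - g x|] of the coderivative quotient lies
    between [|h|] and a multiple of [|h|], because [g] is Lipschitz at [x].  The
    limsup condition on [z] is therefore equivalent to [<w, h> <= o(h)]
    ([coderivativeP]), which says that [w] is a Fréchet subgradient of the zero
    function; moving along the ray [h = t w], [t > 0], forces [w = 0]
    ([subgradient0_eq0]).

    For part (a), [sqn] is the quotient of two quadratic forms by the Euclidean
    length (in complex notation, [u^2 / |u|]).  Its differential at [z != 0]
    comes from the product rule and the derivative of [s |-> 1 / sqrt s], which
    exists because [z1^2 + z2^2 > 0]; the Jacobian is then read off from the
    differential. *)

(** * Euclidean inner product and norm *)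

Section Euclidean.
Context {R : realType} {n : nat}.
Implicit Types (a b u v w x : 'rV[R]_n).

Lemma dotvDr a u v : dotv a (u + v) = dotv a u + dotv a v.
Proof.
by rewrite /dotv -big_split; apply: eq_bigr => i _; rewrite mxE mulrDr.
Qed.

Lemma dotvBl a b u : dotv (a - b) u = dotv a u - dotv b u.
Proof.
by rewrite /dotv -sumrB; apply: eq_bigr => i _; rewrite !mxE mulrBl.
Qed.

Lemma dotv0l u : dotv 0 u = 0.
Proof. by rewrite /dotv big1// => i _; rewrite mxE mul0r. Qed.

Lemma dotvZl a u (t : R) : dotv (t *: a) u = t * dotv a u.
Proof. by rewrite /dotv mulr_sumr; apply: eq_bigr => i _; rewrite mxE mulrA. Qed.

Lemma dotvZr a u (t : R) : dotv a (t *: u) = t * dotv a u.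
Proof. by rewrite /dotv mulr_sumr; apply: eq_bigr => i _; rewrite mxE mulrCA. Qed.

Lemma dotv_enorm v : dotv v v = enorm v ^+ 2.
Proof. by rewrite sqr_sqrtr// sumr_ge0// => i _; rewrite -expr2 sqr_ge0. Qed.

Lemma enorm_ge0 v : 0 <= enorm v.
Proof. exact: sqrtr_ge0. Qed.

Lemma enorm_gt0 v : (0 < enorm v) = (v != 0).
Proof.
apply/idP/idP => [|v0].
  by apply: contraTneq => ->; rewrite /enorm dotv0l sqrtr0 ltxx.
by apply: lt_le_trans (normv_le_enorm v); rewrite normr_gt0.
Qed.

Lemma enormZ v (t : R) : 0 <= t -> enorm (t *: v) = t * enorm v.
Proof.
move=> t0; rewrite /enorm dotvZr dotvZl mulrA -expr2.
by rewrite sqrtrM ?sqr_ge0// sqrtr_sqr ger0_norm.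
Qed.

(** Hölder's inequality for the pair of the l1 and sup norms; it stands in for
    Cauchy-Schwarz, since remainders of differentials are controlled in the sup
    norm. *)
Lemma dotv_le_norm a v : `|dotv a v| <= (\sum_i `|a 0 i|) * `|v|.
Proof.
rewrite /dotv mulr_suml; apply: le_trans (ler_norm_sum _ _ _) _.
by apply: ler_sum => i _; rewrite normrM ler_wpM2l// normv_coord.
Qed.

(** The only Fréchet subgradient of the zero function is zero: at a point
    [u = x + t w] with [t > 0], the assumption reads [|w| <= e]. *)
Lemma subgradient0_eq0 x w :
  (forall e : R, 0 < e ->
    \forall u \near x^', dotv w (u - x) <= e * enorm (u - x)) -> w = 0.
Proof.
move=> H; apply/eqP; apply: contraT => w0.
have Ew : 0 < enorm w by rewrite enorm_gt0.
have nw : 0 < `|w| by rewrite normr_gt0.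
have e0 : 0 < enorm w / 2 by rewrite divr_gt0.
(* The step puts the test point at distance [d / 2] from [x]. *)
have /nbhs_ballP [d /= d0 /(_ (x + (d / (2 * `|w|)) *: w))] := H _ e0.
set t := d / _; have t0 : 0 < t by rewrite divr_gt0// mulr_gt0.
have -> : x + t *: w - x = t *: w by rewrite addrC addKr.
rewrite (enormZ _ (ltW t0)) dotvZr dotv_enorm.
rewrite -ball_normE/= opprD addNKr normrN normrZ gtr0_norm//.
rewrite -subr_eq0 addrC addKr scaler_eq0 negb_or w0 (gt_eqF t0)/=.
have -> : t * `|w| = d / 2 by rewrite /t; field; rewrite gt_eqF.
have dd : d / 2 < d by lra.
move=> /(_ dd isT); rewrite leNgt => /negbTE <-.
by rewrite expr2 mulrCA ltr_pM2l// ltr_pM2r//; lra.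
Qed.

End Euclidean.

Lemma dotv_mulmx_tr (R : realType) (n m : nat) (A : 'M[R]_(n, m))
    (y : 'rV[R]_m) (h : 'rV[R]_n) :
  dotv (y *m A^T) h = dotv y (h *m A).
Proof.
rewrite /dotv; under eq_bigr do rewrite mxE mulr_suml.
under [RHS]eq_bigr do rewrite mxE mulr_sumr.
rewrite exchange_big; apply: eq_bigr => j _; apply: eq_bigr => i _.
by rewrite mxE; ring.
Qed.

(** * Coderivatives of differentiable maps *)

Lemma limf_esup_EFin_le0P (R : realType) (T : choiceType) (X : filteredType T)
    (f : X -> R) (F : set_system X) (FF : Filter F) :
  (limf_esup (fun u => (f u)%:E) F <= 0)%E <->
  (forall e : R, 0 < e -> \forall u \near F, f u <= e).
Proof.
split=> [H e e0|H].
  have /ereal_inf_lt [_ [V FV <-] Ve] :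
      (limf_esup (fun u => (f u)%:E) F < e%:E)%E by exact: le_lt_trans H _.
  apply: filterS FV => u Vu; rewrite -lee_fin; apply: le_trans (ltW Ve).
  by apply: ereal_sup_ubound; exists u.
apply/lee_addgt0Pr => e e0; rewrite add0e.
apply: ge_ereal_inf.
exists (ereal_sup ((fun u => (f u)%:E) @` [set u | f u <= e])).
  by exists [set u | f u <= e] => //; exact: H.
by apply: ge_ereal_sup => _ [u fue <-]; rewrite lee_fin.
Qed.

Section CoderivativeOfDifferentiable.
Context {R : realType} {n m : nat} {g : 'rV[R]_n -> 'rV[R]_m} {x : 'rV[R]_n}.
Hypothesis dg : differentiable g x.

Let A := 'J g x.

Lemma jacobian_remainder (e : R) : 0 < e ->
  \forall u \near x, `|g u - g x - (u - x) *m A| <= e * `|u - x|.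
Proof.
have cA : continuous (mulmxr A : {linear 'rV[R]_n -> 'rV[R]_m}).
  exact: mulmxr_continuous.
apply: (proj1 (is_differential_nearP _ _ cA)); split=> //.
by rewrite funeqE => h; rewrite /= /A mul_rV_lin1.
Qed.

Lemma dotv_jacobian_remainder (y : 'rV[R]_m) (e : R) : 0 < e ->
  \forall u \near x,
    `|dotv y (g u - g x - (u - x) *m A)| <= e * enorm (u - x).
Proof.
set S := \sum_i `|y 0 i|; have S0 : 0 <= S by apply: sumr_ge0.
(* [S] may vanish, hence the [+ 1] in the tolerance. *)
move=> e0; have eS : 0 < e / (S + 1) by rewrite divr_gt0// ltr_wpDl.
apply: filterS (jacobian_remainder eS) => u Hu.
apply: le_trans (dotv_le_norm _ _) _; rewrite -/S.
apply: le_trans (ler_wpM2l S0 Hu) _.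
rewrite mulrA; apply: ler_pM; rewrite ?normv_le_enorm//.
  by rewrite mulr_ge0// ltW.
by rewrite mulrCA ler_piMr ?(ltW e0)// ler_pdivrMr ?mul1r ?lerDl ?ltr_wpDl.
Qed.

Lemma differentiable_lipschitz_at : exists2 C : R, 0 <= C &
  \forall u \near x, enorm (g u - g x) <= C * enorm (u - x).
Proof.
have [k k0 Ak] : exists2 k : R, 0 < k &
    forall h : 'rV[R]_n, `|h *m A| <= k * `|h|.
  exact: (@linear_lipschitz _ _ _ (mulmxr A) (@mulmxr_continuous _ _ _ A)).
exists (m%:R * (1 + k)); first by rewrite mulr_ge0// addr_ge0// ltW.
apply: filterS (jacobian_remainder ltr01) => u; rewrite mul1r => Hr.
apply: le_trans (enorm_le_normv _) _; rewrite -mulrA ler_wpM2l//.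
rewrite -[g u - g x](subrK ((u - x) *m A)) mulrDl mul1r.
apply: le_trans (ler_normD _ _) _; apply: lerD.
  exact: le_trans Hr (normv_le_enorm _).
by apply: le_trans (Ak _) _; rewrite ler_pM2l// normv_le_enorm.
Qed.

(** Up to a factor, the denominator of the coderivative quotient is
    [enorm (u - x)], and its numerator is [dotv (z - y *m A^T) (u - x)] up to a
    negligible term. *)
Lemma coderivativeP (y : 'rV[R]_m) (z : 'rV[R]_n) :
  coderivative g x y z <->
  (forall e : R, 0 < e -> \forall u \near x^',
     dotv (z - y *m A^T) (u - x) <= e * enorm (u - x)).
Proof.
have numE (u : 'rV[R]_n) : dotv z (u - x) - dotv y (g u - g x) =
    dotv (z - y *m A^T) (u - x) - dotv y (g u - g x - (u - x) *m A).
  have -> : dotv y (g u - g x) =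
      dotv y (g u - g x - (u - x) *m A) + dotv y ((u - x) *m A).
    by rewrite -dotvDr subrK.
  by rewrite dotvBl dotv_mulmx_tr; ring.
have den_gt0 (u : 'rV[R]_n) : u != x ->
    0 < enorm (u - x) + enorm (g u - g x).
  by move=> ux; rewrite ltr_wpDr ?enorm_ge0// enorm_gt0 subr_eq0.
split=> [/limf_esup_EFin_le0P H e e0|H].
  have [C C0 gC] := differentiable_lipschitz_at.
  (* A tolerance [e'] for the quotient costs [e' (1 + C) |u - x|]; the other
     half of [e] pays for the remainder. *)
  have C1 : 0 < 1 + C by rewrite ltr_pwDl.
  have e2 : 0 < e / 2 by rewrite divr_gt0.
  have := H _ (divr_gt0 e2 C1); have := dotv_jacobian_remainder y e2.
  move: gC; rewrite /dnbhs /within/=; apply: filterS3 => u Hg Hd Hu ux.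
  have := Hu ux; rewrite numE ler_pdivrMr ?den_gt0// => Hz.
  have Hden : e / 2 / (1 + C) * (enorm (u - x) + enorm (g u - g x)) <=
      e / 2 * enorm (u - x).
    have -> : e / 2 * enorm (u - x) =
        e / 2 / (1 + C) * ((1 + C) * enorm (u - x)).
      by field; rewrite gt_eqF.
    by rewrite ler_pM2l ?divr_gt0// mulrDl mul1r lerD2l.
  by move: Hd Hz Hden; rewrite ler_norml => /andP[_]; lra.
apply/limf_esup_EFin_le0P => e e0; have e2 : 0 < e / 2 by rewrite divr_gt0.
have := H _ e2; have := dotv_jacobian_remainder y e2.
rewrite /dnbhs /within/=; apply: filterS2 => u Hd Hz ux.
rewrite numE ler_pdivrMr ?den_gt0//; have {Hz} := Hz ux.
have := mulr_ge0 (ltW e0) (enorm_ge0 (g u - g x)).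
by move: Hd; rewrite ler_norml mulrDr => /andP[Hd _]; lra.
Qed.

Lemma coderivative_of_differentiable : coderivative_eq_mx g x ('J g x)^T.
Proof.
move=> y; rewrite eqEsubset; split=> [z /coderivativeP H|_ ->].
  exact/subr0_eq/(subgradient0_eq0 H).
apply/coderivativeP => e e0; rewrite subrr; apply: filterE => u.
by rewrite dotv0l mulr_ge0 ?enorm_ge0// ltW.
Qed.

End CoderivativeOfDifferentiable.

(** * Differentials of row-vector-valued maps *)

Lemma jacobian_eq (R : realType) (n m : nat) (f : 'rV[R]_n -> 'rV[R]_m)
    (x : 'rV[R]_n) (A : 'M[R]_(n, m)) :
  is_diff x f (fun h => h *m A) -> 'J f x = A.
Proof.
by move=> df; apply/row_matrixP => i; rewrite !rowE mul_rV_lin1/= diff_val.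
Qed.

Lemma mulmx_mat2 (R : realType) (h : 'rV[R]_2) (a b c d : R) :
  h *m mat2 a b c d =
  vec2 (h 0 0 * a + h 0 1 * c) (h 0 0 * b + h 0 1 * d).
Proof.
apply/rowP => j; rewrite !mxE !big_ord_recl big_ord0 addr0 !mxE/=.
have -> : lift ord0 ord0 = 1 :> 'I_2 by exact: val_inj.
by case: ifP.
Qed.

Lemma tr_mat2 (R : realType) (a b c d : R) : (mat2 a b c d)^T = mat2 a c b d.
Proof. by apply/matrixP => i j; rewrite !mxE; do 2 case: ifP. Qed.

Lemma is_diff_vec2 (R : realType) (V : normedModType R) (f g df dg : V -> R)
    (x : V) :
  is_diff x f df -> is_diff x g dg ->
  is_diff x (fun u => vec2 (f u) (g u)) (fun h => vec2 (df h) (dg h)).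
Proof.
have E (a b : V -> R) : (fun u => vec2 (a u) (b u)) =
    ((fun t : R => t *: vec2 1 0) \o a) + ((fun t : R => t *: vec2 0 1) \o b).
  rewrite funeqE => u; apply/rowP => j; rewrite !fctE/= !mxE.
  by case: ifP => _; rewrite ?mulr0 ?mulr1 ?addr0 ?add0r.
by move=> dfx dgx; rewrite !E; exact: is_diffD.
Qed.

Lemma is_diff_coord (R : realType) (n : nat) (x : 'rV[R]_n) (j : 'I_n) :
  is_diff x (fun u : 'rV[R]_n => u 0 j) (fun h => h 0 j).
Proof.
pose coord (u : 'rV[R]_n) : R := u 0 j.
have lin : linear coord by move=> t u v; rewrite /coord !mxE.
pose coordM := GRing.isLinear.Build _ _ _ _ _ lin.
pose coordL : {linear 'rV[R]_n -> R} := HB.pack coord coordM.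
apply: DiffDef; first exact: differentiable_coord.
by rewrite (_ : (fun _ => _) = coordL)//; apply: diff_lin; exact: coord_continuous.
Qed.

Lemma is_diff_rsqrt (R : realType) (t : R) : 0 < t ->
  is_diff t (fun s => (Num.sqrt s)^-1) (fun h => - h / (2 * t * Num.sqrt t)).
Proof.
move=> t0; have [ds sE] := is_derive1_sqrt t0.
have st : Num.sqrt t != 0 by rewrite gt_eqF// sqrtr_gt0.
have dsq : differentiable (@Num.sqrt R) t by exact/derivable1_diffP.
apply: DiffDef; first exact: differentiableV.
rewrite diffV// funeqE => h /=; rewrite diff1E//= derive1E sE /GRing.scale/=.
(* Eliminating [t] as the square of its root leaves a rational identity. *)
by move: st (sqr_sqrtr (ltW t0)); move: (Num.sqrt t) => s s0 <-; field.
Qed.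

(** * The map [u^2 / |u|] and its derivatives *)

(** The case distinction at the origin disappears because [0^-1 = 0]. *)
Lemma sqnE (R : realType) : @sqn R = fun u =>
  vec2 ((u 0 0 ^+ 2 - u 0 1 ^+ 2) / Num.sqrt (u 0 0 ^+ 2 + u 0 1 ^+ 2))
       (2 * u 0 0 * u 0 1 / Num.sqrt (u 0 0 ^+ 2 + u 0 1 ^+ 2)).
Proof.
rewrite funeqE => u; rewrite /sqn; case: eqP => //= ->.
apply/rowP => j; rewrite !mxE.
by case: ifP; rewrite !expr0n/= ?subrr ?mulr0 ?mul0r.
Qed.

Lemma is_diff_sqn (R : realType) (z : 'rV[R]_2) (hz : z != 0) :
  let z1 := z 0 0 in
  let z2 := z 0 1 in
  let D := (z1 ^+ 2 + z2 ^+ 2) * Num.sqrt (z1 ^+ 2 + z2 ^+ 2) in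
  is_diff z (@sqn R) (fun h => h *m
    mat2 ((z1 ^+ 2 + 3 * z2 ^+ 2) * z1 / D)    (2 * z2 ^+ 2 * z2 / D)
         (- (3 * z1 ^+ 2 + z2 ^+ 2) * z2 / D)  (2 * z1 ^+ 2 * z1 / D)).
Proof.
move=> z1 z2 D; pose q : R := z1 ^+ 2 + z2 ^+ 2.
have q0 : 0 < q.
  have : dotv z z = q.
    rewrite /dotv !big_ord_recl big_ord0 addr0 -!expr2.
    by have -> : lift ord0 ord0 = 1 :> 'I_2 by exact: val_inj.
  by move=> <-; rewrite dotv_enorm exprn_gt0// enorm_gt0.
pose x1 : 'rV[R]_2 -> R := fun u => u 0 0.
pose x2 : 'rV[R]_2 -> R := fun u => u 0 1.
have d1 : is_diff z x1 x1 by exact: is_diff_coord.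
have d2 : is_diff z x2 x2 by exact: is_diff_coord.
have dr : is_diff z
    (((fun s => (Num.sqrt s)^-1) : R -> R) \o (x1 ^+ 2 + x2 ^+ 2))
    ((fun h => - h / (2 * q * Num.sqrt q)) \o
     ((2 * x1 z ^+ 1) *: x1 + (2 * x2 z ^+ 1) *: x2)).
  by apply: is_diff_comp; exact: is_diff_rsqrt.
rewrite sqnE; apply: is_diff_eq.
  exact: (is_diff_vec2
    (is_diffM (is_diffB (is_diffX 1 d1) (is_diffX 1 d2)) dr)
    (is_diffM (is_diffM (is_diffZ 2 d1) d2) dr)).
rewrite funeqE => h; rewrite !fctE/= mulmx_mat2.
have s0 : Num.sqrt q != 0 by rewrite gt_eqF// sqrtr_gt0.
have qn0 : z1 ^+ 2 + z2 ^+ 2 != 0 by rewrite gt_eqF.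
rewrite /x1 /x2 -/z1 -/z2 /D -/q /GRing.scale/=.
by congr vec2; rewrite /q in s0 *; field; rewrite qn0 s0.
Qed.

Theorem theorem3p3 (R : realType) (z : 'rV[R]_2) (hz : z != 0) :
  let z1 := z 0 0 in
  let z2 := z 0 1 in
  let D := (z1 ^+ 2 + z2 ^+ 2) * Num.sqrt (z1 ^+ 2 + z2 ^+ 2) in
  (differentiable (@sqn R) z /\
   'J (@sqn R) z =
     mat2 ((z1 ^+ 2 + 3 * z2 ^+ 2) * z1 / D)    (2 * z2 ^+ 2 * z2 / D)
          (- (3 * z1 ^+ 2 + z2 ^+ 2) * z2 / D)  (2 * z1 ^+ 2 * z1 / D)) /\
  (mordukhovich_differentiable (@sqn R) z /\
   coderivative_eq_mx (@sqn R) z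
     (mat2 ((z1 ^+ 2 + 3 * z2 ^+ 2) * z1 / D) (- (3 * z1 ^+ 2 + z2 ^+ 2) * z2 / D)
           (2 * z2 ^+ 2 * z2 / D)             (2 * z1 ^+ 2 * z1 / D)) /\
   (forall x y : 'rV[R]_2, coderivative (@sqn R) z y = [set x] ->
      x 0 0 = y 0 0 * ((z1 ^+ 2 + 3 * z2 ^+ 2) * z1 / D)
              + y 0 1 * (2 * z2 ^+ 2 * z2 / D) /\
      x 0 1 = y 0 0 * ((- 3 * z1 ^+ 2 - z2 ^+ 2) * z2 / D)
              + y 0 1 * (2 * z1 ^+ 2 * z1 / D))).
Proof.
move=> z1 z2 D; have dz := is_diff_sqn hz; rewrite -/z1 -/z2 -/D in dz.
have dsqn : differentiable (@sqn R) z by exact: ex_diff.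
have JE := jacobian_eq dz.
have cE := coderivative_of_differentiable dsqn; rewrite JE tr_mat2 in cE.
split; first by [].
split; first by move=> y; rewrite cE; eexists.
split; first by [].
move=> x y; rewrite cE => /esym xE.
have -> : x = y *m mat2 ((z1 ^+ 2 + 3 * z2 ^+ 2) * z1 / D)
    (- (3 * z1 ^+ 2 + z2 ^+ 2) * z2 / D) (2 * z2 ^+ 2 * z2 / D)
    (2 * z1 ^+ 2 * z1 / D).
  have : [set x] x by [].
  by rewrite xE.
by rewrite mulmx_mat2 !mxE/= opprD mulNr.
Qed.
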